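(* Let $k\ge 2$ and $n\ge 2$ be integers. Suppose $n^2\le k(n-1)+1$ and suppose $\overline{a}=(k-1)/n\ge 1$ is an integer. Suppose \[ \gamma=\left\lfloor \frac{k}{\overline{a}+3}\right\rfloor\ge 1. \] Then there is an optimal $\mathsf{OA}_{\lambda}(k,n)$, where \[ \lambda=\binom{k-2}{\overline{a}-1}(n-1)^{k-\overline{a}-\gamma-1}. \]
   Context: For integers $k\ge 2$, $n\ge 2$, $\lambda\ge 1$, an orthogonal array $\mathsf{OA}_{\lambda}(k,n)$ is a $\lambda n^2$ by $k$ array with entries from a set $X$ of cardinality $n$ such that, within any two distinct columns, every ordered pair of symbols from $X$ occurs in exactly $\lambda$ rows (rows may be repeated). An $\mathsf{OA}_{\lambda}(k,n)$ is optimal if it contains a row that is repeated exactly $m=\frac{\lambda n^2}{k(n-1)+1}$ times (in particular this number is a positive integer). *)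

(* Defs.v *)
From mathcomp Require Import all_boot all_order all_algebra.

Set Implicit Arguments.
Unset Strict Implicit.
Unset Printing Implicit Defensive.

Definition orthogonal_array (lambda k n : nat) (X : finType)
    (A : 'M[X]_(lambda * n ^ 2, k)) : Prop :=
  [/\ 2 <= k, 2 <= n, 1 <= lambda, #|X| = n &
      forall c1 c2 : 'I_k, c1 != c2 ->
      forall x y : X,
        #|[set r : 'I_(lambda * n ^ 2) | (A r c1 == x) && (A r c2 == y)]|
        = lambda].

Definition row_multiplicity (X : finType) (N k : nat) (A : 'M[X]_(N, k))
    (r : 'I_N) : nat :=
  #|[set s : 'I_N | row s A == row r A]|.

(* The divisibility makes the natural-number quotient exact. Positivity of the
   quotient is automatic: it is the multiplicity of a row that occurs. *)
Definition optimal_orthogonal_array (lambda k n : nat) (X : finType)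
    (A : 'M[X]_(lambda * n ^ 2, k)) : Prop :=
  [/\ @orthogonal_array lambda k n X A,
      k * (n - 1) + 1 %| lambda * n ^ 2 &
      exists r : 'I_(lambda * n ^ 2),
        row_multiplicity A r = (lambda * n ^ 2) %/ (k * (n - 1) + 1)].

Definition has_optimal_OA (lambda k n : nat) : Prop :=
  exists (X : finType) (A : 'M[X]_(lambda * n ^ 2, k)),
    @optimal_orthogonal_array lambda k n X A.

(* Main.v *)
Require Import Defs.
From mathcomp Require Import all_boot all_order all_algebra.
From mathcomp Require Import zify.

Set Implicit Arguments.
Unset Strict Implicit.
Unset Printing Implicit Defensive.

Import GRing.Theory.

(** Put q = n - 1 and let the n symbols be one blank symbol together with an
    abelian group G of order q, so that k = aq + a + 1. Consider the words of
    length k with exactly a blanks. Added to a suitable number of copies of the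
    all-blank word they form an orthogonal array: two given columns are both
    non-blank, with given entries, in C(k-2, a) q^(k-a-2) words, and exactly
    one of them is blank, with the other entry given, in
    C(k-2, a-1) q^(k-a-1) words; since k - 1 - a = aq these numbers agree. The
    pair (blank, blank) occurs less often in the words, and the copies of the
    all-blank word make up the difference.

    To save a factor q^gamma, cut gamma disjoint blocks of a + 3 consecutive
    columns out of the k columns, and keep only the words whose group entries
    sum to 0 on every block. Once the a blank positions and the entries of two
    further columns are prescribed, a block of size a + 3 still has a free
    column. Translating the entry in that column by G changes the sum of its
    own block and nothing else, so each checksum condition divides every pair
    count by exactly q (card_code_pinned). All the counts shrink by the same
    factor, so the array stays balanced.

    Optimality is then arithmetic. If c00 is the number of kept words that are
    blank in two given columns, then (aq + 1) c00 = (a - 1) q lambda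
    (bin_excess), hence m = lambda - c00 satisfies (aq + 1) m = lambda n,
    which is the required value because k(n - 1) + 1 = (aq + 1) n. *)

(** * Counting tools *)

(** The translations s_j permute A and carry the zero fibre of f onto the fibre
    over j, so all fibres have the same size. *)
Lemma card_balanced_fibre (T : finType) (G : finZmodType) (A : {set T})
    (f : T -> G) (s : G -> T -> T) :
  (forall j, injective (s j)) -> (forall j v, (s j v \in A) = (v \in A)) ->
  (forall j v, v \in A -> f (s j v) = (f v + j)%R) ->
  #|A| = #|[set v in A | f v == 0%R]| * #|G|.
Proof.
move=> s_inj sA fs.
have fibre j : #|[set v in A | f v == j]| = #|[set v in A | f v == 0%R]|.
  rewrite -(card_preimset _ (s_inj j)); apply: eq_card => v.
  rewrite !inE sA; case: (boolP (v \in A)) => //= vA.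
  by rewrite fs // -subr_eq0 addrK.
rewrite -sum1_card (partition_big f predT) //= mulnC -sum_nat_const.
apply: eq_bigr => j _; rewrite -(fibre j) -sum1_card.
by apply: eq_bigl => v; rewrite !inE.
Qed.

(** A set with trace W on C is W together with an arbitrary part of the
    complement of C. The test guards against the truncated subtraction, which
    would give 1 instead of 0 when W has more than a elements. *)
Lemma card_setI_draws (T : finType) (C W : {set T}) (a : nat) :
  W \subset C ->
  #|[set Z : {set T} | (#|Z| == a) && (Z :&: C == W)]|
  = if #|W| <= a then 'C(#|~: C|, a - #|W|) else 0.
Proof.
move=> WC; case: ifP => [Wa|/negbT]; last first.
  rewrite -ltnNge => aW; apply/eqP; rewrite cards_eq0 -subset0.
  apply/subsetP=> Z; rewrite !inE => /andP[/eqP Za /eqP ZC].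
  by move: aW; rewrite -Za -ZC ltnNge subset_leq_card // subsetIl.
have disjW (A : {set T}) : A \subset ~: C -> A :&: C = set0.
  by move=> AC; apply/eqP; rewrite setI_eq0 disjoints_subset.
have WIC : W :&: C = W by apply/setIidPl.
rewrite -cards_draws.
have inj : {in [set A : {set T} | (A \subset ~: C) && (#|A| == a - #|W|)] &,
    injective (fun A => A :|: W)}.
  move=> A B; rewrite !inE => /andP[AC _] /andP[BC _] eqAB.
  have : (A :|: W) :\: C = (B :|: W) :\: C by rewrite eqAB.
  have WD : W :\: C = set0 by apply/eqP; rewrite setD_eq0.
  by rewrite !setDUl WD !setU0 !setDE !(setIidPl _).
rewrite -(card_in_imset inj); apply: eq_card => Z; rewrite !inE.
apply/andP/imsetP => [[/eqP Za /eqP ZC]|[A]].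
  exists (Z :\: C); last by rewrite -ZC setUC setID.
  by rewrite inE setDE subsetIr -setDE cardsD ZC Za /=.
rewrite inE => /andP[AC /eqP cA] ->; rewrite setIUl disjW // set0U WIC eqxx.
rewrite cardsU -{2}WIC [W :&: C]setIC setIA disjW // set0I cards0 cA.
by rewrite subn0 subnK.
Qed.

Lemma card_consecutive_block k d g :
  g.+1 * d <= k -> d <= #|[set i : 'I_k | i %/ d == g]|.
Proof.
move=> gd; have lt_k (j : 'I_d) : g * d + j < k.
  by apply: leq_trans gd; rewrite mulSn addnC ltn_add2r.
rewrite -[X in X <= _]card_ord -cardsT.
have inj : injective (fun j => Ordinal (lt_k j)).
  by move=> i j [] /addnI /val_inj.
rewrite -(card_imset _ inj); apply: subset_leq_card.
apply/subsetP => _ /imsetP[j _ ->]; rewrite inE /=.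
have d_gt0 : 0 < d by apply: leq_ltn_trans (ltn_ord j).
by rewrite divnMDl // divn_small // addn0.
Qed.

Lemma count_uniform_pairs (T : Type) (X : finType) (f g : T -> X) l (s : seq T) :
  (forall x y, count (fun v => (f v == x) && (g v == y)) s = l) ->
  size s = l * #|X| ^ 2.
Proof.
move=> unif; rewrite -sum1_size (partition_big (fun v => (f v, g v)) predT) //=.
rewrite (eq_bigr (fun=> l)); last first.
  by move=> [x y] _; rewrite -(unif x y) -sum1_count; apply: eq_bigl.
by rewrite sum_nat_const card_prod mulnC -mulnn.
Qed.

Lemma card_nth_count (X : Type) (x0 : X) (s : seq X) (P : pred X) N :
  size s = N -> #|[set r : 'I_N | P (nth x0 s r)]| = count P s.
Proof.
move=> sN; rewrite -sum1_count (big_nth x0) sN big_mkord -sum1_card.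
by apply: eq_bigl => r; rewrite inE.
Qed.

Lemma count_enum_set (T : finType) (A : {set T}) (P : pred T) :
  count P (enum A) = #|[set v in A | P v]|.
Proof.
rewrite -sum1_count big_enum_cond -sum1_card.
by apply: eq_bigl => v; rewrite !inE.
Qed.

Lemma card_setI2 (T : finType) (A : {set T}) (c d : T) :
  c != d -> #|A :&: [set c; d]| = (c \in A) + (d \in A).
Proof.
move=> cd; rewrite (cardsD1 c) (cardsD1 d) !inE !eqxx orbT !andbT.
rewrite [d == c]eq_sym cd /= [X in _ + (_ + X)](_ : _ = 0) ?addn0 //.
apply/eqP; rewrite cards_eq0 -subset0; apply/subsetP => i; rewrite !inE.
by case: (i == c); case: (i == d); rewrite ?andbF.
Qed.

(** * Words with a prescribed number of blanks and zero block sums *)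

Section Code.

Variables (I : finType) (G : finZmodType).
Implicit Types (u v : {ffun I -> option G}) (Z C : {set I}) (b : I -> nat).

Definition blanks v : {set I} := [set i | v i == None].

(** The map b assigns columns to blocks; blanks do not contribute to the sum
    of a block. *)
Definition checksum b (g : nat) v : G := (\sum_(i | b i == g) odflt 0 (v i))%R.

(** Only the blocks 0, ..., t - 1 are checked, so columns with a larger label
    are unconstrained. *)
Definition checked b (t : nat) v : bool :=
  all (fun g => checksum b g v == 0%R) (iota 0 t).

Definition code b (t a : nat) : {set {ffun I -> option G}} :=
  [set v | (#|blanks v| == a) && checked b t v].

Definition agree C u v : bool := [forall i in C, v i == u i].

(** Blanks are left in place, so that the blank set is preserved. *)
Definition shift (p : I) (j : G) v : {ffun I -> option G} :=
  [ffun i => if i == p then omap (+%R^~ j) (v i) else v i].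

Lemma shift_inj p j : injective (shift p j).
Proof.
move=> u v /ffunP uv; apply/ffunP => i; have := uv i; rewrite !ffunE.
case: ifP => // _; case: (u i) (v i) => [x|] [y|] //= [] /addIr -> //.
Qed.

Lemma blanks_shift p j v : blanks (shift p j v) = blanks v.
Proof.
by apply/setP => i; rewrite !inE ffunE; case: ifP => // _; case: (v i).
Qed.

Lemma agree_shift p j C u v :
  p \notin C -> agree C u (shift p j v) = agree C u v.
Proof.
move=> pC; apply: eq_forallb => i; rewrite ffunE; case: (i =P p) => // ->.
by rewrite (negPf pC).
Qed.

Lemma checksum_shift p j b g v : p \notin blanks v ->
  checksum b g (shift p j v)
  = (checksum b g v + if b p == g then j else 0)%R.
Proof.
rewrite inE => vp; rewrite /checksum; case: ifP => [bp|/negbT bp].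
  rewrite (bigD1 p) //= [in RHS](bigD1 p) //= ffunE eqxx addrAC; congr (_ + _)%R.
    by case: (v p) vp.
  by apply: eq_bigr => i /andP[_ /negPf ip]; rewrite ffunE ip.
rewrite addr0; apply: eq_bigr => i bi; rewrite ffunE.
by case: (i =P p) => // ip; rewrite -ip bi in bp.
Qed.

(** Every column outside Z and C takes any of the #|G| non-blank symbols, and
    the others are forced; the hypothesis says that Z and u do not contradict
    each other on C. *)
Lemma card_pinned Z C u : Z :&: C = blanks u :&: C ->
  #|[set v | (blanks v == Z) && agree C u v]| = #|G| ^ #|~: (Z :|: C)|.
Proof.
move=> ZC.
pose F i : pred (option G) :=
  if i \in C then pred1 (u i) else if i \in Z then pred1 None else predC1 None.
have -> : #|[set v | (blanks v == Z) && agree C u v]| = #|family F|.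
  apply: eq_card => v; rewrite inE; apply/andP/familyP.
    move=> [/eqP vZ /forall_inP vu] i; rewrite /F -vZ.
    case: (boolP (i \in C)) => iC; first exact: vu.
    by rewrite inE; case: (boolP (v i == None)).
  move=> vF; split; last first.
    by apply/forall_inP => i iC; have := vF i; rewrite /F iC.
  apply/eqP/setP => i; rewrite inE; have := vF i; rewrite /F.
  case: (boolP (i \in C)) => iC.
    move=> /eqP ->; have /setP/(_ i) := ZC.
    by rewrite !inE iC !andbT => ->.
  by case: (boolP (i \in Z)) => iZ; [move=> /eqP -> | move=> /negPf].
rewrite card_family -prod_nat_const foldrE big_map big_enum /=.
rewrite [RHS]big_mkcond; apply: eq_bigr => i _; rewrite !inE /F.
case: (i \in C); first by rewrite orbT card1.
case: (i \in Z); first by rewrite card1.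
by rewrite /= cardC1 card_option.
Qed.

(** Each checksum costs one factor #|G|: block g contains a free column p, and
    shifting the entry at p translates the checksum of g and leaves the other
    blocks alone. *)
Lemma card_pinned_checked b t Z C u :
  (forall g, g < t -> exists2 p, p \notin Z :|: C & b p = g) ->
  #|[set v | [&& blanks v == Z, agree C u v & checked b t v]]| * #|G| ^ t
  = #|[set v | (blanks v == Z) && agree C u v]|.
Proof.
elim: t => [_|t IHt pivot].
  by rewrite muln1; apply: eq_card => v; rewrite !inE andbT.
rewrite -IHt; last by move=> g gt; apply: pivot; apply: ltnW.
have [p pZC bp] := pivot t (ltnSn t).
have [pZ pC] : p \notin Z /\ p \notin C by move: pZC; rewrite inE => /norP.
rewrite expnS mulnA; congr (_ * _).
rewrite [RHS](@card_balanced_fibre _ G _ (checksum b t) (shift p)).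
- congr (_ * _); apply: eq_card => v; rewrite !inE /checked -addn1 iotaD all_cat.
  by rewrite /= andbT !andbA.
- exact: shift_inj.
- move=> j v; rewrite !inE blanks_shift agree_shift //.
  case: eqP => //= vZ; congr (_ && _); apply: eq_in_all => g.
  rewrite mem_iota add0n /= => gt; rewrite checksum_shift ?vZ // bp.
  by rewrite gtn_eqF // addr0.
- move=> j v; rewrite !inE => /and3P[/eqP vZ _ _].
  by rewrite checksum_shift ?vZ // bp eqxx.
Qed.

(** Sort the words by their blank set Z. Its trace on C is that of u, and
    every block, being larger than a + #|C|, keeps a column outside Z and C,
    so the previous count applies with the same value for all Z. *)
Lemma card_code_pinned b t a C u :
  (forall g, g < t -> a + #|C| < #|[set i | b i == g]|) ->
  #|[set v in code b t a | agree C u v]| * #|G| ^ t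
  = (if #|blanks u :&: C| <= a then 'C(#|~: C|, a - #|blanks u :&: C|) else 0)
    * #|G| ^ (#|I| - (a + #|C| - #|blanks u :&: C|)).
Proof.
move=> blk; rewrite -card_setI_draws ?subsetIr // -[RHS]sum_nat_const.
rewrite -sum1_card (partition_big blanks
  (fun Z : {set I} => Z \in
    [set Z : {set I} | (#|Z| == a) && (Z :&: C == blanks u :&: C)])).
  rewrite big_distrl; apply: eq_bigr => Z /=.
  rewrite inE => /andP[/eqP Za /eqP ZC].
  have cZC : #|Z :|: C| = a + #|C| - #|blanks u :&: C| by rewrite cardsU Za ZC.
  transitivity (#|[set v | (blanks v == Z) && agree C u v]|); last first.
    by rewrite card_pinned // -cZC [#|~: _|]cardsCs setCK.
  rewrite -(card_pinned_checked (b := b) (t := t)).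
    rewrite -sum1_card; congr (_ * _); apply: eq_bigl => v; rewrite !inE.
    case: (blanks v =P Z) => [->|]; last by rewrite andbF.
    by rewrite Za eqxx /= andbT andbC.
  move=> g gt; have /subsetPn[p] : ~~ ([set i | b i == g] \subset Z :|: C).
    apply/negP => /subset_leq_card; rewrite leqNgt => /negP; apply.
    by rewrite (leq_trans _ (blk g gt)) // ltnS cZC leq_subr.
  by rewrite inE => /eqP bp pZC; exists p.
move=> v; rewrite !inE => /andP[/andP[-> _]] /forall_inP vu /=.
apply/eqP/setP => i; rewrite !inE; case: (boolP (i \in C)) => iC; last by rewrite !andbF.
by rewrite (eqP (vu i iC)).
Qed.

End Code.

(** * Arrays from lists of words *)

Section Array.

Variables (k : nat) (X : finType).
Implicit Types (s : seq {ffun 'I_k -> X}) (z : {ffun 'I_k -> X}).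

(** The pair counts in two columns force the list to have l * #|X| ^ 2 words,
    so its positions index the rows, and z is the repeated row. *)
Lemma optimal_OA_of_seq s z (l : nat) :
  2 <= k -> 2 <= #|X| -> 0 < l ->
  (forall c d : 'I_k, c != d -> forall x y : X,
     count (fun v : {ffun _} => (v c == x) && (v d == y)) s = l) ->
  0 < count_mem z s ->
  count_mem z s * (k * (#|X| - 1) + 1) = l * #|X| ^ 2 ->
  has_optimal_OA l k #|X|.
Proof.
move=> hk hX l_gt0 unif z_gt0 opt.
pose c0 := Ordinal (ltnW hk); pose c1 := Ordinal hk.
have sz : size s = l * #|X| ^ 2.
  exact: count_uniform_pairs (unif c0 c1 isT).
pose A : 'M_(l * #|X| ^ 2, k) := (\matrix_(r, c) nth z s r c)%R.
exists X, A; split.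
- split=> // c d cd x y; rewrite -[RHS](unif c d cd x y) -(card_nth_count z _ sz).
  by apply: eq_card => r; rewrite !inE !mxE.
- by rewrite -opt dvdn_mull.
have zs : z \in s by rewrite -has_pred1 has_count.
have r_lt : index z s < l * #|X| ^ 2 by rewrite -sz index_mem.
exists (Ordinal r_lt); rewrite /row_multiplicity.
rewrite -[RHS](congr1 (divn^~ _) opt) mulnK ?addn1 //.
rewrite -(card_nth_count z _ sz); apply: eq_card => r; rewrite !inE.
apply/eqP/eqP => [/rowP eqr|eqr].
  apply/ffunP => c; have := eqr c.
  by rewrite !mxE /= nth_index.
by apply/rowP => c; rewrite !mxE /= eqr nth_index.
Qed.

End Array.

(** * The construction *)

(** Here and below a stands for one less than the number of blanks, and
    a.+1 * q + a is k - 2. This is the equality of the pair counts with no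
    blank and with one blank. *)
Lemma bin_balance q a : 'C(a.+1 * q + a, a.+1) = q * 'C(a.+1 * q + a, a).
Proof.
apply/eqP; rewrite -(eqn_pmul2l (ltn0Sn a)) mul_bin_left addnK; apply/eqP.
by rewrite mulnA.
Qed.

(** Compares the pair count with two blanks to the one with a single blank; a
    word with a single blank (a = 0) has no pair of blanks. *)
Lemma bin_excess q a (c := if 0 < a then 'C(a.+1 * q + a, a.-1) else 0) :
  (a.+1 * q + 1) * c = a * 'C(a.+1 * q + a, a).
Proof.
rewrite /c; case: a {c} => [|a] /=; first by rewrite muln0.
rewrite mul_bin_left; congr (_ * _).
lia.
Qed.

(** With a + 1 blanks, a block of a + 4 columns has a column that is neither
    blank nor one of the two columns being counted. *)
Lemma optimal_OA_blocks (a q t : nat) (k := a.+1 * q.+1 + 1) :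
  0 < q -> t * (a + 4) <= k ->
  has_optimal_OA ('C(k - 2, a) * q ^ (k - a.+1 - t - 1)) k q.+1.
Proof.
move=> q_gt0 tk; set l := _ * _.
have k2 : k - 2 = a.+1 * q + a by rewrite /k; lia.
have qE : q = #|'I_q.-1.+1| by rewrite card_ord prednK.
(* The predecessor exposes a successor, which is what makes 'I_q a group. *)
pose G : finZmodType := 'I_q.-1.+1.
pose X : finType := option G.
have XE : q.+1 = #|X| by rewrite card_option -qE.
pose C : {set {ffun 'I_k -> X}} := code G (fun i : 'I_k => i %/ (a + 4)) t a.+1.
pose z : {ffun 'I_k -> X} := [ffun=> None].
pose c00 := (if 0 < a then 'C(k - 2, a.-1) else 0) * q ^ (k - a.+1 - t).
have pin (c d : 'I_k) (x y : X) : c != d ->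
    count (fun v : {ffun 'I_k -> X} => (v c == x) && (v d == y)) (enum C)
    = if (x == None) && (y == None) then c00 else l.
  move=> cd.
  pose u : {ffun 'I_k -> X} := [ffun i => if i == c then x else y].
  have qt_gt0 : 0 < q ^ t by rewrite expn_gt0 q_gt0.
  have uc : u c = x by rewrite ffunE eqxx.
  have ud : u d = y by rewrite ffunE eq_sym (negPf cd).
  have c2 : #|[set c; d]| = 2 by rewrite cards2 cd.
  rewrite count_enum_set; apply/eqP; rewrite -(eqn_pmul2r qt_gt0); apply/eqP.
  transitivity (#|[set v in C | agree [set c; d] u v]| * q ^ t).
    congr (_ * _); apply: eq_card => v; rewrite !inE; congr (_ && _).
    apply/andP/forall_inP => [[/eqP vc /eqP vd] i|agr].
      by rewrite !inE => /orP[] /eqP ->; rewrite ?vc ?vd ?uc ?ud.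
    by rewrite -{1}uc -{1}ud !agr ?inE ?eqxx ?orbT.
  rewrite [in LHS]qE card_code_pinned; last first.
    move=> g gt; rewrite c2; apply: leq_trans (card_consecutive_block _).
      by rewrite addSn addn2 addn4.
    by apply: leq_trans tk; rewrite leq_mul2r gt orbT.
  rewrite -qE card_setI2 // !inE uc ud c2 cardsCs setCK c2 card_ord.
  have t1k : a.+1 + t + 2 <= k by rewrite /k in tk *; nia.
  (* Cases: both columns blank, one blank (twice), none blank. *)
  rewrite /c00 /l; case: (x == None); case: (y == None) => /=.
  - rewrite -mulnA -expnD; congr (_ * _ ^ _); last lia.
    by rewrite -[1 + 1]/2 ltnS subSS subn1.
  - rewrite -mulnA -expnD; congr ('C(_, _) * _ ^ _); lia.
  - rewrite -mulnA -expnD; congr ('C(_, _) * _ ^ _); lia.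
  rewrite addn0 !subn0 k2 bin_balance -k2 -!mulnA -expnD mulnCA -expnS.
  congr (_ * _ ^ _); lia.
(* In each pair of columns (blank, blank) is rarer than the other pairs. *)
have qm : (a.+1 * q + 1) * c00 = a * q * l.
  rewrite /c00 mulnA k2 bin_excess -mulnA /l -k2 -mulnA; congr (_ * _).
  have -> : k - a.+1 - t = (k - a.+1 - t - 1).+1 by rewrite /k in tk *; nia.
  by rewrite expnS mulnCA !subn1.
have l_gt0 : 0 < l.
  by rewrite muln_gt0 expn_gt0 q_gt0 bin_gt0 k2 leq_addl.
(* So a positive number of all-blank rows fills the gap. *)
have c00l : c00 < l.
  have pos : 0 < a.+1 * q + 1 by rewrite addn1.
  rewrite -(ltn_pmul2l pos) qm ltn_pmul2r //.
  by rewrite addn1 ltnS leq_mul2r leqnSn orbT.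
have zC : count_mem z (enum C) = 0.
  apply/count_memPn; rewrite mem_enum inE.
  have -> : blanks z = setT by apply/setP => i; rewrite !inE ffunE.
  rewrite cardsT card_ord (_ : k == a.+1 = false) //; rewrite /k; lia.
have mult : count_mem z (nseq (l - c00) z ++ enum C) = l - c00.
  by rewrite count_cat count_nseq zC /= eqxx mul1n addn0.
rewrite [X in has_optimal_OA _ _ X]XE.
apply: (@optimal_OA_of_seq _ _ (nseq (l - c00) z ++ enum C) z) => //.
- by rewrite /k; nia.
- by rewrite -XE.
- move=> c d cd x y; rewrite count_cat pin // count_nseq !ffunE.
  rewrite [None == x]eq_sym [None == y]eq_sym.
  by case: ifP => _; rewrite ?mul1n ?subnK // ltnW.
- by rewrite mult subn_gt0.
rewrite mult -XE subn1 /=.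
have -> : k * q + 1 = q.+1 * (a.+1 * q + 1) by rewrite /k; nia.
rewrite mulnC -mulnA mulnBr qm -mulnBl -mulnn.
have -> : a.+1 * q + 1 - a * q = q.+1 by nia.
by rewrite mulnA mulnC.
Qed.

Theorem corollary4p6 (k n : nat) (hk : 2 <= k) (hn : 2 <= n)
    (hkn : n ^ 2 <= k * (n - 1) + 1) (hdvd : n %| k - 1) :
  let a := (k - 1) %/ n in
  let gamma := k %/ (a + 3) in
  let lambda := 'C(k - 2, a - 1) * (n - 1) ^ (k - a - gamma - 1) in
  1 <= a -> 1 <= gamma -> has_optimal_OA lambda k n.
Proof.
move=> a t l a_gt0 t_gt0.
have kan : k = a * n + 1 by rewrite divnK // subnK // ltnW.
have tk : t * (a + 3) <= k by apply: leq_trunc_div.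
have nE : n = (n - 1).+1 by rewrite subn1 prednK // ltnW.
have aE : a = (a - 1).+1 by rewrite subn1 prednK.
have kE : k = (a - 1).+1 * (n - 1).+1 + 1 by rewrite -aE -nE.
have := @optimal_OA_blocks (a - 1) (n - 1) t.
rewrite -kE -aE -nE; apply => //; first by rewrite subn_gt0.
by rewrite (_ : a - 1 + 4 = a + 3) // {2}aE !addnS.
Qed.
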